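(* Let $r,s\in\mathbb R$ with $r\ne0$, and let $R_1$ be the analytic (connected) subgroup of $R=AN$ whose Lie algebra is spanned by $$J_1+\tfrac12J_2+sV,\qquad W,\qquad M,\qquad L+rV .$$ Then the action of $R_1$ by left translation on the open orbit $\mathcal U=R\cdot[u]\subset AdS_4=G/H$ is free and simply transitive.
   Context: $G=\mathrm{SO}_0(2,3)$ is the identity component of the group of real $5\times5$ matrices of determinant $1$ preserving $\eta=\mathrm{diag}(-1,-1,1,1,1)$, and $H=\mathrm{SO}_0(1,3)$ is the identity component of the subgroup fixing the first basis vector; $AdS_4=G/H$, with $[g]$ the class $gH$. $E_{ij}$ are elementary matrices. $R=AN$ is the connected Iwasawa subgroup with Lie algebra $\mathfrak r=\mathrm{span}\{J_1,J_2,W,V,M,L\}$, where $J_1=E_{24}+E_{42}$, $J_2=E_{13}+E_{31}$, $W=E_{25}+E_{45}+E_{52}-E_{54}$, $V=E_{15}+E_{35}+E_{51}-E_{53}$, and $M,L$ are zero except for the upper-left $4\times4$ blocks $$M=\begin{pmatrix}0&1&0&-1\\-1&0&1&0\\0&1&0&-1\\-1&0&1&0\end{pmatrix},\quad L=\begin{pmatrix}0&1&0&-1\\-1&0&-1&0\\0&-1&0&1\\-1&0&-1&0\end{pmatrix}.$$ The nonzero brackets are $[V,W]=M$, $[V,L]=2W$, $[J_1,W]=W$, $[J_2,V]=V$, $[J_1,L]=L$, $[J_2,L]=-L$, $[J_1,M]=M$, $[J_2,M]=M$. $u\in G$ is the matrix whose upper-left $2\times 2$ block is $\begin{pmatrix}0&1\\-1&0\end{pmatrix}$,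 whose lower-right $3\times3$ block is the identity, and whose other entries are zero. *)

(* Defs.v *)
From HB Require Import structures.
From mathcomp Require Import all_boot all_order all_algebra.
From mathcomp Require Import all_classical all_reals all_analysis.
Import Order.TTheory GRing.Theory Num.Theory.
Import numFieldNormedType.Exports.

Set Implicit Arguments.
Unset Strict Implicit.
Unset Printing Implicit Defensive.

Local Open Scope classical_set_scope.
Local Open Scope ring_scope.

Section AdS4.
Variable K : realType.
Local Notation mx := 'M[K]_5.

(* Elementary matrices, with 1-based indices (1 <= i, j <= 5). *)
Definition E (i j : nat) : mx := delta_mx (inord i.-1) (inord j.-1).

(* Rows listed from the top; unlisted entries are 0. *)
Definition mx_of_rows (rows : seq (seq int)) : mx :=
  \matrix_(i, j) (nth 0 (nth [::] rows i) j)%:~R.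

Definition eta : mx := diag_mx (\row_(j < 5) if (j < 2)%N then -1 else 1).

Definition SO23 : set mx := [set g | g^T *m eta *m g = eta /\ \det g = 1].

Definition G : set mx := connected_component SO23 1.

Definition e1 : 'cV[K]_5 := delta_mx ord0 ord0.

Definition H : set mx := connected_component [set g | G g /\ g *m e1 = e1] 1.

Definition ltrans (g : mx) (X : set mx) : set mx := [set g *m x | x in X].

Definition cls (g : mx) : set mx := ltrans g H.

(* The points of AdS_4 = G / H are the left cosets g H, with g in G. *)
Definition AdS4 : set (set mx) := [set cls g | g in G].

Definition orbit (S : set mx) (x : set mx) : set (set mx) :=
  [set ltrans g x | g in S].

Definition subgroupGL (S : set mx) : Prop :=
  [/\ S `<=` [set g | g \in unitmx], S 1,
      (forall g h, S g -> S h -> S (g *m h)) &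
      (forall g, S g -> S (invmx g))].

Definition expmx (X : mx) : mx :=
  lim (series (fun n : nat => n`!%:R^-1 *: X ^+ n) @ \oo).

(* The connected Lie subgroup with Lie algebra h is the subgroup generated by
   exp(h); this is meant for h closed under the commutator bracket. *)
Definition analytic_subgroup (h : {vspace mx}) : set mx :=
  smallest subgroupGL (expmx @` [set X | X \in h]).

Definition J1 : mx := E 2 4 + E 4 2.
Definition J2 : mx := E 1 3 + E 3 1.
Definition W : mx := E 2 5 + E 4 5 + E 5 2 - E 5 4.
Definition V : mx := E 1 5 + E 3 5 + E 5 1 - E 5 3.
Definition M : mx := mx_of_rows
  [:: [::  0; 1; 0; -1];
      [:: -1; 0; 1;  0];
      [::  0; 1; 0; -1];
      [:: -1; 0; 1;  0]].
Definition L : mx := mx_of_rows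
  [:: [::  0;  1;  0; -1];
      [:: -1;  0; -1;  0];
      [::  0; -1;  0;  1];
      [:: -1;  0; -1;  0]].

Definition R : set mx := analytic_subgroup <<[:: J1; J2; W; V; M; L]>>%VS.

(* With [V, L] = 2 W, [V, W] = M and the weights of J1 and J2, this span is
   closed under the bracket for all r and s. *)
Definition R1 (r s : K) : set mx :=
  analytic_subgroup
    <<[:: J1 + 2^-1 *: J2 + s *: V; W; M; L + r *: V]%R>>%VS.

Definition u : mx := mx_of_rows
  [:: [::  0; 1; 0; 0; 0];
      [:: -1; 0; 0; 0; 0];
      [::  0; 0; 1; 0; 0];
      [::  0; 0; 0; 1; 0];
      [::  0; 0; 0; 0; 1]].

Definition U : set (set mx) := orbit R (cls u).

Definition acts_on (S : set mx) (X : set (set mx)) : Prop :=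
  forall g x, S g -> X x -> X (ltrans g x).

Definition acts_freely (S : set mx) (X : set (set mx)) : Prop :=
  forall g x, S g -> X x -> ltrans g x = x -> g = 1.

Definition acts_simply_transitively (S : set mx) (X : set (set mx)) : Prop :=
  forall x y, X x -> X y -> exists! g, S g /\ ltrans g x = y.

End AdS4.

Arguments SO23 : clear implicits.
Arguments G : clear implicits.
Arguments H : clear implicits.
Arguments AdS4 : clear implicits.
Arguments R : clear implicits.
Arguments U : clear implicits.

(* Main.v *)
Require Import Defs.
From HB Require Import structures.
From mathcomp Require Import all_boot all_order all_algebra.
From mathcomp Require Import all_classical all_reals all_analysis.
From mathcomp Require Import ring lra.
Import Order.TTheory GRing.Theory Num.Theory.
Import numFieldNormedType.Exports.
Local Open Scope classical_set_scope.
Local Open Scope ring_scope.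

(** A coset [g u H] determines the vector [g u e1], because [H] fixes [e1], and
    [u e1 = - e2]; so the action on [U] is controlled by the action on [e2].
    In the weight basis
      [f1 = e2 + e4], [f2 = e1 + e3], [e5], [f2' = e1 - e3], [f1' = e2 - e4]
    the Lie algebra of [R] is upper triangular, hence [R] consists of
    eta-isometries that are upper triangular with positive diagonal (lemma
    [R_borel]).  Let [S] be the stabilizer of [e2] in [R].  The theorem follows
    from [R = R1 S], [R1] and [S] meeting only in [1], and [S] being contained
    in [u H u^-1]: then [U] is a single [R1]-orbit ([U_R1_orbit]) and the
    stabilizer in [R1] of its base point is trivial ([R1_cls_u_free]).

    - [R1] acts transitively on [R e2] ([R1_transitive_points]).  Writing
      [e2 = (f1 + f1') / 2], one applies successively the exponentials of
      multiples of [J1 + J2/2 + s V], [L + r V], [W], [M]; their parameters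
      adjust in turn the coordinates along [f1'], [f2'], [e5] and [f2], and the
      last coordinate is forced because the eta-norm is preserved.

    - [S] lies in [u H u^-1] ([e2_stab_conj_H]).  A triangular isometry fixing
      [e2] fixes both [f1] and [f1'], and is then [exp (nu V) exp (a J2)].
      As [V] and [J2] kill [e2], the paths [exp (t X)] join these elements to
      [1] inside the stabilizer of [e2].

    - [R1] and [S] meet only in [1] ([R1_e2_stab]).  For an element of [R1] let
      [lam], [mu] be the first two diagonal entries and [kap], [nu] the two
      entries just above the diagonal, in positions [(f1, f2)] and [(f2, e5)].
      Then [lam = mu^2], since the diagonal part of the Lie algebra of [R1] is
      spanned by [J1 + J2/2].  Under this relation [kap / mu] and [nu] are both
      cocycles for the same character [mu], as is [mu - 1]; so the linear relation
      [nu = 2 s (mu - 1) - (r / 2) (kap / mu)], which holds for the exponentials,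
      is stable under products.  An element of [S] has [lam = 1] and [kap = 0],
      so if it lies in [R1] then [mu = 1] and [nu = 0].

    About the exponential series, what is used is that it converges, that it
    turns sums of commuting matrices into products, and that [t -> exp (t X)]
    is continuous.  For [X] in so(2,3) this makes [exp (t X)] a path of
    eta-isometries, of determinant [1] because [exp X] is the square of
    [exp (X / 2)]; hence [exp X] is in [G] ([expmx_G]). *)

(** * Limits of matrices and products of exponential sums *)

Lemma mx_cvg_entrywise {K : realType} {m n : nat} {T : Type}
    {F : set_system T} {FF : Filter F} (f : T -> 'M[K]_(m, n)) (l : 'M[K]_(m, n)) :
  (forall i j, f x i j @[x --> F] --> l i j) -> f @ F --> l.
Proof.
move=> fl; apply/cvg_ballP => e e0.
have : forall i, \forall x \near F, forall j, ball (l i j) e (f x i j).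
  by move=> i; apply: filter_forall => j; move/cvg_ballP: (fl i j) => /(_ e e0).
by move/filter_forall; apply: filterS => x fx; split.
Qed.

Lemma cvg_mx_entry {K : realType} {m n : nat} {T : Type}
    {F : set_system T} {FF : Filter F} (f : T -> 'M[K]_(m, n)) (l : 'M[K]_(m, n)) i j :
  f @ F --> l -> f x i j @[x --> F] --> l i j.
Proof.
move=> fl; apply: (@continuous_cvg _ _ _ _ _ f (fun M : 'M[K]_(m, n) => M i j)) => //.
exact: coord_continuous.
Qed.

(** The product of two partial sums of the exponential overshoots the partial
    sum at [a + b] by the terms of the square [i, j < N] outside the triangle
    [i + j < N].  It is stated for an arbitrary algebra because the error for
    matrices is bounded by the same identity for real numbers. *)
Lemma mul_exp_partial_sums (K : numFieldType) (A : algType K) (a b : A) N :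
  GRing.comm a b ->
  (\sum_(0 <= i < N) i`!%:R^-1 *: a ^+ i) *
  (\sum_(0 <= j < N) j`!%:R^-1 *: b ^+ j) =
  (\sum_(0 <= k < N) k`!%:R^-1 *: (a + b) ^+ k) +
  \sum_(0 <= i < N) \sum_(0 <= j < N | (N <= i + j)%N)
     (i`!%:R^-1 * j`!%:R^-1) *: (a ^+ i * b ^+ j).
Proof.
move=> cab.
rewrite mulr_suml.
under eq_bigr => i _.
  rewrite mulr_sumr.
  under eq_bigr => j _ do rewrite -scalerAl -scalerAr scalerA.
  rewrite (bigID (fun j => i + j < N)%N) /=.
  under [X in _ + X]eq_bigl => j do rewrite -leqNgt.
  over.
rewrite big_split /=; congr (_ + _).
transitivity (\sum_(0 <= i < N) \sum_(0 <= k < N | (i <= k)%N)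
   (i`!%:R^-1 * (k - i)`!%:R^-1) *: (a ^+ i * b ^+ (k - i))).
  apply: eq_big_nat => i /andP[_ iN].
  rewrite -(big_nat_widenl i 0%N N predT) //.
  rewrite -{4}[i]add0n big_addn.
  under [RHS]eq_bigr => k _ do rewrite addnK.
  rewrite [RHS](big_nat_widen _ _ N) ?leq_subr //.
  by apply: eq_bigl => j; rewrite ltn_subRL.
rewrite (exchange_big_dep predT) //=.
apply: eq_big_nat => k /andP[_ kN].
rewrite addrC exprDn_comm; last exact: commr_sym.
rewrite -(big_mkord predT (fun i => b ^+ (k - i) * a ^+ i *+ 'C(k, i))) scaler_sumr.
rewrite [RHS](big_nat_widen _ _ N) //; apply: eq_big => // i ik.
rewrite -[_ *+ 'C(k, i)]scaler_nat scalerA; congr (_ *: _).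
  rewrite -(bin_fact ik) !natrM.
  have nz n : (0 < n)%N -> n%:R != 0 :> K by rewrite pnatr_eq0 lt0n.
  by field; rewrite !nz ?fact_gt0 ?bin_gt0.
exact: commrX (commr_sym (commrX _ (commr_sym cab))).
Qed.

Ltac mx5_cases :=
  apply/matrixP => -[[|[|[|[|[|//]]]]] ?] [[|[|[|[|[|//]]]]] ?].
Ltac cV5_cases := apply/matrixP => -[[|[|[|[|[|//]]]]] ?] [[|//] ?].

(** * The exponential of 5 x 5 matrices *)

Section AntiDeSitter.
Variable K : realType.
Local Notation mx := 'M[K]_5.
Implicit Types A B X : mx.

Definition entries_le (c : K) A := forall i j, `|A i j| <= c.

(** The maximum of the entries is submultiplicative only up to the factor [5]. *)
Lemma entries_le_mul c d A B : entries_le c A -> entries_le d B ->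
  entries_le (5 * (c * d)) (A * B).
Proof.
move=> Ac Bd i j; rewrite mxE (le_trans (ler_norm_sum _ _ _)) //.
have -> : 5 * (c * d) = \sum_(k < 5) (c * d).
  by rewrite sumr_const card_ord mulr_natl.
by apply: ler_sum => k _; rewrite normrM ler_pM.
Qed.

Lemma entries_le_exp A :
  exists2 c, 0 <= c & forall n, entries_le (c ^+ n) (A ^+ n).
Proof.
pose c := \sum_i \sum_j `|A i j|.
have c0 : 0 <= c by rewrite sumr_ge0 // => i _; rewrite sumr_ge0.
have Ac : entries_le c A.
  move=> i j; rewrite /c (bigD1 i) //= (bigD1 j) //= -!addrA lerDl.
  rewrite addr_ge0 ?sumr_ge0 // => k _; exact: sumr_ge0.
exists (5 * c); first by rewrite mulr_ge0.
elim=> [|n IH].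
  move=> i j; rewrite !expr0 mxE; case: (i == j); rewrite ?normr1 ?normr0 //.
by rewrite !exprS -mulrA; exact: entries_le_mul.
Qed.

Definition expsum n A : mx := \sum_(0 <= k < n) k`!%:R^-1 *: A ^+ k.

Lemma expsum_entry n A i j :
  expsum n A i j = series (fun k => k`!%:R^-1 * (A ^+ k) i j) n.
Proof.
by rewrite /expsum /series /= summxE; apply: eq_bigr => k _; rewrite mxE.
Qed.

Lemma is_cvg_expsum_entry A i j :
  cvgn (series (fun k => k`!%:R^-1 * (A ^+ k) i j)).
Proof.
have [c c0 Ac] := entries_le_exp A.
apply: normed_cvg; apply: series_le_cvg (is_cvg_series_exp_coeff c) => [n|n|n] /=.
- exact: normr_ge0.
- exact: exp_coeff_ge0.
- rewrite normrM ger0_norm ?invr_ge0 // mulrC ler_wpM2r ?invr_ge0 //.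
  exact: Ac.
Qed.

Lemma expsum_cvg A : expsum n A @[n --> \oo] --> expmx A.
Proof.
have H : expsum n A @[n --> \oo] -->
   \matrix_(i, j) limn (series (fun k => k`!%:R^-1 * (A ^+ k) i j)).
  apply: mx_cvg_entrywise => i j; rewrite mxE.
  under eq_cvg do rewrite expsum_entry.
  exact: is_cvg_expsum_entry.
by rewrite /expmx (cvg_lim _ H).
Qed.

Lemma expmx_unique A B :
  (forall i j, expsum n A i j @[n --> \oo] --> B i j) -> expmx A = B.
Proof.
move=> AB; apply/matrixP => i j.
have AE : expsum n A i j @[n --> \oo] --> expmx A i j.
  by apply: cvg_mx_entry; exact: expsum_cvg.
by rewrite -(cvg_lim _ AE) // (cvg_lim _ (AB i j)).
Qed.

(** By [mul_exp_partial_sums] the difference between the product of the partial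
    sums and the partial sum at [A + B] is a sum over the pairs [i + j >= N].
    If [c^n] and [d^n] bound the entries of [A^n] and [B^n], this sum is at most
    [5] times the same one for the real numbers [c] and [d], which tends to [0]
    because [exp (c + d) = exp c * exp d]. *)
Lemma expmxD A B : GRing.comm A B -> expmx (A + B) = expmx A * expmx B.
Proof.
move=> cAB; apply: expmx_unique => i j.
have [c c0 Ac] := entries_le_exp A; have [d d0 Bd] := entries_le_exp B.
have prod_cvg : (expsum n A * expsum n B) i j @[n --> \oo]
    --> (expmx A * expmx B) i j.
  rewrite mxE; under eq_cvg do rewrite mxE.
  apply: cvg_big => [|k _]; first exact: add_continuous.
  by apply: cvgM; apply: cvg_mx_entry; exact: expsum_cvg.
have scal_cvg (x : K) : series (exp_coeff x) n @[n --> \oo] --> expR x.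
  exact: is_cvg_series_exp_coeff.
have tail_cvg : 5 * (series (exp_coeff c) n * series (exp_coeff d) n
    - series (exp_coeff (c + d)) n) @[n --> \oo] --> (0 : K).
  rewrite -(mulr0 5) -(subrr (expR (c + d))) {1}expRD.
  apply: cvgM; first exact: cvg_cst.
  exact: (cvgB (cvgM (scal_cvg c) (scal_cvg d)) (scal_cvg (c + d))).
suff diff_cvg : (expsum n A * expsum n B) i j - expsum n (A + B) i j
    @[n --> \oo] --> (0 : K).
  rewrite -[(expmx A * expmx B) i j]subr0.
  under eq_cvg => n do rewrite -[expsum n _ i j](subKr ((expsum n A * expsum n B) i j)).
  exact: cvgB.
apply: norm_cvg0; apply: (squeeze_cvgr _ (cvg_cst _) tail_cvg).
near=> n; rewrite normr_ge0 /=.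
have -> : expsum n A * expsum n B = _ := mul_exp_partial_sums K mx A B n cAB.
have := mul_exp_partial_sums K K^o c d n (mulrC _ _).
have scalE (x : K) : \sum_(0 <= i < n) i`!%:R^-1 *: (x : K^o) ^+ i
    = series (exp_coeff x) n by rewrite exp_coeffE.
rewrite !scalE => -> /=.
rewrite mxE [in leLHS]addrAC subrr add0r [in leRHS]addrAC subrr add0r summxE.
rewrite (le_trans (ler_norm_sum _ _ _)) // mulr_sumr ler_sum // => k _.
rewrite summxE (le_trans (ler_norm_sum _ _ _)) // mulr_sumr ler_sum // => l _.
rewrite mxE normrM ger0_norm ?mulr_ge0 ?invr_ge0 // mulrCA.
by rewrite ler_wpM2l ?mulr_ge0 ?invr_ge0 //; exact: entries_le_mul.
Unshelve. all: by end_near. Qed.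

Lemma cvg_mulmx3 {T : Type} {F : set_system T} {FF : Filter F} {p q : nat}
    (f : T -> mx) B (P : 'M[K]_(p, 5)) (Q : 'M[K]_(5, q)) i j :
  f @ F --> B -> (P *m f n *m Q) i j @[n --> F] --> (P *m B *m Q) i j.
Proof.
move=> fB; rewrite mxE; under eq_cvg do rewrite mxE.
apply: cvg_big => [|k _]; first exact: add_continuous.
apply: cvgM; last exact: cvg_cst.
rewrite mxE; under eq_cvg do rewrite mxE.
apply: cvg_big => [|l _]; first exact: add_continuous.
by apply: cvgM; [exact: cvg_cst | exact: cvg_mx_entry].
Qed.

Lemma cvg_expsum_mulmx3 {p q : nat} X (P : 'M[K]_(p, 5)) (Q : 'M[K]_(5, q)) i j :
  (P *m expsum n X *m Q) i j @[n --> \oo] --> (P *m expmx X *m Q) i j.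
Proof. by apply: cvg_mulmx3; exact: expsum_cvg. Qed.

(** Reads off one matrix coefficient of [exp X] when that coefficient of the powers
    of [X] is geometric; [b = 0] gives the vanishing coefficients. *)
Lemma expmx_matrix_coef {p q : nat} X (P : 'M[K]_(p, 5)) (Q : 'M[K]_(5, q)) i j a b :
  (forall n, (P *m X ^+ n *m Q) i j = b * a ^+ n) ->
  (P *m expmx X *m Q) i j = b * expR a.
Proof.
move=> Xn; have XL := cvg_expsum_mulmx3 X P Q i j.
have YL : (P *m expsum n X *m Q) i j @[n --> \oo] --> b * expR a.
  have E n : (P *m expsum n X *m Q) i j = b * series (exp_coeff a) n.
    rewrite /expsum mulmx_sumr mulmx_suml summxE exp_coeffE mulr_sumr.
    by apply: eq_bigr => k _; rewrite -scalemxAr -scalemxAl mxE Xn mulrCA.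
  under eq_cvg do rewrite E.
  by apply: cvgM; [exact: cvg_cst | exact: is_cvg_series_exp_coeff].
by rewrite -(cvg_lim _ XL) // (cvg_lim _ YL).
Qed.

Lemma expmx_nilpotent {q : nat} X (Q : 'M[K]_(5, q)) d :
  X ^+ d *m Q = 0 ->
  expmx X *m Q = \sum_(0 <= k < d) k`!%:R^-1 *: (X ^+ k *m Q).
Proof.
move=> XQ0; apply/matrixP => i j; rewrite -[expmx X *m Q]mul1mx mulmxA.
have XL := cvg_expsum_mulmx3 X 1%:M Q i j.
rewrite -(cvg_lim _ XL) //; apply: cvg_lim => //; apply: cvg_near_cst.
near=> n; rewrite mul1mx mulmx_suml.
have dn : (d <= n)%N by near: n; exact: nbhs_infty_ge.
rewrite (big_cat_nat _ dn) //= [X in _ + X]big_nat_cond [X in _ + X]big1.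
  rewrite addr0; congr (fun_of_matrix _ i j).
  by apply: eq_bigr => k _; rewrite scalemxAl.
move=> k /andP[/andP[dk _] _]; rewrite -scalemxAl -(subnK dk) exprD.
by rewrite -mulmxE -mulmxA XQ0 mulmx0 scaler0.
Unshelve. all: by end_near. Qed.

Lemma expmx0 : expmx (0 : mx) = 1.
Proof.
rewrite -[LHS]mulmx1 (expmx_nilpotent 0 1%:M 1) ?expr1 ?mul0mx //.
by rewrite big_nat1 invr1 scale1r expr0 mul1mx.
Qed.

Lemma expmxN X : expmx (- X) * expmx X = 1.
Proof.
rewrite -expmxD ?addNr ?expmx0 //.
by apply: commr_sym; apply: commrN; exact: commr_refl.
Qed.

Lemma expmx_intertwine X Y P : Y * P = P * X -> expmx Y * P = P * expmx X.
Proof.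
move=> YP; apply/matrixP => i j.
have YL := cvg_expsum_mulmx3 Y 1%:M P i j.
have XL := cvg_expsum_mulmx3 X P 1%:M i j.
rewrite -[expmx Y * P]/(expmx Y *m P) -[expmx Y]mul1mx.
rewrite -[P * expmx X]/(P *m expmx X) -[P *m _]mulmx1.
rewrite -(cvg_lim _ YL) // -(cvg_lim _ XL) //; congr (limn _).
apply/funext => n; rewrite mul1mx mulmx1; congr (fun_of_matrix _ i j).
rewrite mulmx_suml mulmx_sumr; apply: eq_bigr => k _.
rewrite -scalemxAl -scalemxAr; congr (_ *: _).
elim: k => [|k IH]; first by rewrite !expr0 mul1mx mulmx1.
by move: IH; rewrite !mulmxE => IH; rewrite !exprSr -mulrA YP mulrA IH -mulrA.
Qed.

Lemma expmx_tr X : expmx X^T = (expmx X)^T.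
Proof.
apply: expmx_unique => i j; rewrite mxE.
have XL : expsum n X j i @[n --> \oo] --> expmx X j i.
  by apply: cvg_mx_entry; exact: expsum_cvg.
have XT k : (X^T) ^+ k = (X ^+ k)^T.
  by elim: k => [|k IH]; rewrite ?expr0 ?trmx1 // exprS exprSr IH -!mulmxE trmx_mul.
under eq_cvg => n.
  rewrite (_ : expsum n X^T i j = expsum n X j i); first over.
  by rewrite !summxE; apply: eq_bigr => k _; rewrite XT !mxE.
by [].
Qed.

(** If [X] is skew for the bilinear form [B] then [B] intertwines [X^T] and [- X],
    hence also their exponentials. *)
Lemma expmx_orth (B X : mx) : X^T *m B = - (B *m X) ->
  (expmx X)^T *m B *m expmx X = B.
Proof.
move=> XB; rewrite -expmx_tr.
have -> : expmx X^T *m B = B *m expmx (- X).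
  by apply: expmx_intertwine; rewrite mulrN.
by rewrite -mulmxA [_ *m expmx X]expmxN mulmx1.
Qed.

(** Since [exp (x X) = exp (t X) exp ((x - t) X)], only continuity at [0] matters;
    there the entries of [exp (h X) - 1] are at most [exp (c |h|) - 1]. *)
Lemma expmx_continuous X : continuous (fun t : K => expmx (t *: X)).
Proof.
have [c c0 Xc] := entries_le_exp X.
have bound h i j : `|(expmx (h *: X) - 1) i j| <= expR (c * `|h|) - 1.
  have L : (expsum n.+1 (h *: X) - 1) i j @[n --> \oo] --> (expmx (h *: X) - 1) i j.
    rewrite [X in _ --> X]mxE; under eq_cvg do rewrite mxE.
    apply: cvgD; last exact: cvg_cst.
    rewrite (cvg_shiftS (fun n => expsum n (h *: X) i j)).
    by apply: cvg_mx_entry; exact: expsum_cvg.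
  have R : series (exp_coeff (c * `|h|)) n.+1 - 1 @[n --> \oo] --> expR (c * `|h|) - 1.
    apply: cvgB; last exact: cvg_cst.
    rewrite (cvg_shiftS (series (exp_coeff (c * `|h|)))).
    exact: is_cvg_series_exp_coeff.
  apply: (ler_cvg_to (cvg_norm L) R); near=> n.
  rewrite /expsum /series /= !big_nat_recl // /exp_coeff /=.
  rewrite !fact0 !expr0 invr1 scale1r ?mulr1 ?mul1r.
  rewrite addrAC subrr add0r addrAC subrr add0r summxE.
  rewrite (le_trans (ler_norm_sum _ _ _)) // ler_sum // => k _.
  rewrite exprZn scalerA mxE !normrM normrX ger0_norm ?invr_ge0 //.
  rewrite exprMn mulrC mulrCA -mulrA [_^-1 * _]mulrC mulrA.
  by rewrite ler_wpM2r ?invr_ge0 // ler_wpM2r ?exprn_ge0 // Xc.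
move=> t; apply: mx_cvg_entrywise => i j.
have small k : (expmx ((x - t) *: X) - 1) k j @[x --> t] --> (0 : K).
  apply: norm_cvg0.
  have B : expR (c * `|x - t|) - 1 @[x --> t] --> (0 : K).
    rewrite -[X in _ --> X](subrr 1) -{2}expR0 -(mulr0 c) -(normr0 K) -(subrr t).
    apply: cvgB; last exact: cvg_cst.
    apply: continuous_cvg; first exact: continuous_expR.
    apply: cvgM; first exact: cvg_cst.
    by apply: cvg_norm; apply: cvgB; [exact: cvg_id | exact: cvg_cst].
  apply: (squeeze_cvgr _ (cvg_cst _) B).
  by near=> x; rewrite normr_ge0 bound.
have E x : expmx (x *: X) i j = expmx (t *: X) i j +
    \sum_k expmx (t *: X) i k * (expmx ((x - t) *: X) - 1) k j.
  have -> : x *: X = t *: X + (x - t) *: X by rewrite -scalerDl addrC subrK.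
  rewrite expmxD.
    rewrite -{1}[expmx ((x - t) *: X)](subrK 1) mulrDr mulr1 mxE.
    by rewrite addrC [X in _ + X]mxE.
  by rewrite /GRing.comm -!scalerAl -!scalerAr !scalerA mulrC.
have sum_cvg : \sum_k expmx (t *: X) i k * (expmx ((x - t) *: X) - 1) k j
    @[x --> t] --> \sum_(k < 5) expmx (t *: X) i k * 0.
  apply: cvg_big => [|k _]; first exact: add_continuous.
  by apply: cvgM; [exact: cvg_cst | exact: small].
rewrite big1 in sum_cvg => [|k _]; last by rewrite mulr0.
under eq_cvg do rewrite E.
have := cvgD (cvg_cst (expmx (t *: X) i j)) sum_cvg.
by rewrite addr0; apply.
Unshelve. all: by end_near. Qed.

(** * Identity components of matrix groups *)

Lemma mulmx_continuous (g : mx) : continuous (mulmx g : mx -> mx).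
Proof.
move=> h.
have E i j : (g *m x *m 1%:M) i j @[x --> h] --> (g *m h *m 1%:M) i j.
  by apply: (@cvg_mulmx3 _ _ (nbhs_filter h) _ _ id).
have -> : (mulmx g : mx -> mx) = (fun x => g *m x *m 1%:M).
  by apply: funext => x; rewrite mulmx1.
exact: (@mx_cvg_entrywise _ _ _ _ _ (nbhs_filter h) _ _ E).
Qed.

(** The translate by [g] of the component of [1] is connected and contains [g],
    so it stays in the component of [g], which is that of [1]. *)
Lemma connected_component1M (T : set mx) :
  T 1 -> (forall g h, T g -> T h -> T (g *m h)) ->
  forall g h, connected_component T 1 g -> connected_component T 1 h ->
  connected_component T 1 (g *m h).
Proof.
move=> T1 TM g h Tg Th; apply: (connected_component_trans Tg).
apply: (@connected_component_max _ _ (mulmx g @` connected_component T 1)).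
- exists 1; [exact: connected_component_refl | exact: mulmx1].
- move=> _ [k Tk <-]; apply: TM; last exact: connected_component_sub Tk.
  exact: connected_component_sub Tg.
- apply: connected_continuous_connected; first exact: component_connected.
  by apply: continuous_subspaceT; exact: mulmx_continuous.
- by exists h.
Qed.

Lemma path_in_component (T : set mx) (f : K -> mx) :
  continuous f -> f 0 = 1 -> (forall t, T (f t)) ->
  forall t, connected_component T 1 (f t).
Proof.
move=> fc f0 fT t; apply: (@connected_component_max _ _ (range f)).
- by exists 0.
- by move=> _ [x _ <-].
- apply: connected_continuous_connected; last exact: continuous_subspaceT.
  by apply/connected_intervalP => x y _ _ z _.
- by exists t.
Qed.

Definition eta_orth : set mx := [set g | g^T *m Defs.eta K *m g = Defs.eta K].

Lemma det_eta_neq0 : \det (Defs.eta K) != 0.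
Proof.
rewrite det_diag prodf_seq_neq0; apply/allP => i _ /=.
by rewrite mxE; case: ifP; rewrite ?oppr_eq0 oner_eq0.
Qed.

Lemma eta_orth_det g : eta_orth g -> \det g ^+ 2 = 1.
Proof.
move=> /(congr1 (fun A => \det A)); rewrite !det_mulmx det_tr mulrAC -expr2.
by move=> /(canRL (mulfK det_eta_neq0)); rewrite divff ?det_eta_neq0.
Qed.

Lemma eta_orth_unit g : eta_orth g -> g \in unitmx.
Proof.
move=> /eta_orth_det g2; rewrite unitmxE unitfE; apply/eqP => g0.
by move/eqP: g2; rewrite g0 expr0n eq_sym oner_eq0.
Qed.

Lemma eta_orthM g h : eta_orth g -> eta_orth h -> eta_orth (g *m h).
Proof.
rewrite /eta_orth /= => go ho.
by rewrite trmx_mul !mulmxA -(mulmxA h^T) -(mulmxA h^T) go.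
Qed.

Lemma eta_orth1 : eta_orth 1.
Proof. by rewrite /eta_orth /= trmx1 mul1mx mulmx1. Qed.

Lemma eta_orthV g : eta_orth g -> eta_orth (invmx g).
Proof.
move=> go; have gu := eta_orth_unit g go; rewrite /eta_orth /=.
rewrite -{1}go trmx_inv !mulmxA mulVmx ?unitmx_tr // mul1mx -mulmxA mulmxV //.
by rewrite mulmx1.
Qed.

(** An eta-isometry has determinant [1] or [-1], so its square has determinant [1]. *)
Lemma SO23_square g : eta_orth g -> SO23 K (g *m g).
Proof.
move=> go; split; first exact: eta_orthM.
by rewrite det_mulmx -expr2 eta_orth_det.
Qed.

Lemma SO23_1 : SO23 K 1.
Proof. by split; [exact: eta_orth1 | exact: det1]. Qed.

Lemma SO23M g h : SO23 K g -> SO23 K h -> SO23 K (g *m h).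
Proof.
move=> [go gd] [ho hd]; split; first exact: eta_orthM.
by rewrite det_mulmx gd hd mulr1.
Qed.

Lemma G1 : G K 1.
Proof. by apply: connected_component_refl; exact: SO23_1. Qed.

Lemma GM g h : G K g -> G K h -> G K (g *m h).
Proof. exact: connected_component1M SO23_1 SO23M g h. Qed.

Lemma H1 : H K 1.
Proof. by apply: connected_component_refl; split; [exact: G1 | rewrite mul1mx]. Qed.

Lemma HM g h : H K g -> H K h -> H K (g *m h).
Proof.
apply: connected_component1M; first by split; [exact: G1 | rewrite mul1mx].
move=> {}g {}h [Gg ge] [Gh he]; split; first exact: GM.
by rewrite -mulmxA he.
Qed.

Lemma H_e1 h : H K h -> h *m e1 K = e1 K.
Proof. by move=> /connected_component_sub[]. Qed.

Definition so23 : set mx := [set X | X^T *m Defs.eta K = - (Defs.eta K *m X)].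

Lemma so23Z t X : so23 X -> so23 (t *: X).
Proof.
by rewrite /so23 /= => Xo; rewrite linearZ /= -scalemxAl Xo -scalemxAr scalerN.
Qed.

(** The determinant is [1] because [exp X] is the square of [exp (X / 2)]. *)
Lemma expmx_SO23 X : so23 X -> SO23 K (expmx X).
Proof.
move=> Xo; have -> : X = 2^-1 *: X + 2^-1 *: X.
  by rewrite -scalerDl -div1r -splitr scale1r.
rewrite expmxD; last exact: commr_refl.
by apply: SO23_square; apply: expmx_orth; exact: so23Z.
Qed.

Lemma expmx_G X : so23 X -> G K (expmx X).
Proof.
move=> Xo; rewrite -[X]scale1r.
apply: (path_in_component _ (fun t => expmx (t *: X))).
- exact: expmx_continuous.
- by rewrite scale0r expmx0.
- by move=> t; apply: expmx_SO23; exact: so23Z.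
Qed.

Definition of_rows (rows : seq (seq K)) : mx :=
  \matrix_(i, j) nth 0 (nth [::] rows i) j.

Lemma sum5 (F : 'I_5 -> K) :
  \sum_(i < 5) F i = F (@Ordinal 5 0 isT) + F (@Ordinal 5 1 isT)
    + F (@Ordinal 5 2 isT) + F (@Ordinal 5 3 isT) + F (@Ordinal 5 4 isT).
Proof.
rewrite !big_ord_recl big_ord0 addr0 !addrA.
by do ?congr (_ + _); congr F; apply: val_inj.
Qed.

(** The rotation in the plane of the two negative directions, joining [1] to [u]
    as [t] runs from [0] to [pi / 2]. *)
Definition rot (t : K) : mx := of_rows
  [:: [:: cos t; sin t; 0; 0; 0];
      [:: - sin t; cos t; 0; 0; 0];
      [:: 0; 0; 1; 0; 0];
      [:: 0; 0; 0; 1; 0];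
      [:: 0; 0; 0; 0; 1]].

Lemma rot_orth t : eta_orth (rot t).
Proof.
have cs : sin t * sin t = 1 - cos t * cos t by rewrite -!expr2 sin2cos2.
rewrite /eta_orth /rot /=.
rewrite -mulmxA mul_diag_mx.
mx5_cases; rewrite mxE sum5 !mxE /=; ring: cs.
Qed.

Lemma rotD a b : rot (a + b) = rot a *m rot b.
Proof.
by rewrite /rot cosD sinD; mx5_cases; rewrite [in RHS]mxE sum5 !mxE /=; ring.
Qed.

Lemma rot_continuous : continuous rot.
Proof.
move=> t; have E i j : rot x i j @[x --> t] --> rot t i j.
  under eq_cvg do rewrite mxE.
  rewrite mxE.
  move: i j => -[[|[|[|[|[|//]]]]] ?] [[|[|[|[|[|//]]]]] ?] /=; try exact: cvg_cst.
  - exact: continuous_cos.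
  - exact: continuous_sin.
  - by apply: cvgN; exact: continuous_sin.
  - exact: continuous_cos.
exact: (@mx_cvg_entrywise _ _ _ _ _ (nbhs_filter t) _ _ E).
Qed.

Lemma u_G : G K (u K).
Proof.
have -> : u K = rot (pi / 2).
  by rewrite /rot cos_pihalf sin_pihalf /u; mx5_cases; rewrite !mxE /=.
apply: (path_in_component _ rot rot_continuous).
- by rewrite /rot cos0 sin0; mx5_cases; rewrite !mxE /=; ring.
- move=> t; rewrite [t]splitr rotD; apply: SO23_square; exact: rot_orth.
Qed.

(** * The weight basis and the Lie algebra of R *)

(** The vector with coordinates [a, b, c, d, e] in the basis [e2 + e4], [e1 + e3],
    [e5], [e1 - e3], [e2 - e4], whose members are weight vectors for [(J1, J2)] of
    weights [(1, 0)], [(0, 1)], [(0, 0)], [(0, -1)], [(-1, 0)]. *)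
Definition wv (a b c d e : K) : 'cV[K]_5 :=
  \col_i nth 0 [:: b + d; a + e; b - d; a - e; c] i.

Lemma wv_surj (v : 'cV[K]_5) : exists a b c d e, v = wv a b c d e.
Proof.
pose x k := v (inord k) ord0.
exists ((x 1 + x 3) / 2), ((x 0 + x 2) / 2), (x 4), ((x 0 - x 2) / 2),
  ((x 1 - x 3) / 2).
have xE (i : 'I_5) j : v i j = x i by rewrite /x inord_val (ord1 j).
by cV5_cases; rewrite mxE xE /=; field.
Qed.

Lemma wv_inj a b c d e a' b' c' d' e' : wv a b c d e = wv a' b' c' d' e' ->
  [/\ a = a', b = b', c = c', d = d' & e = e'].
Proof.
move=> /matrixP E; have E' k (k5 : (k < 5)%N) := E (Ordinal k5) ord0.
have := E' 0 isT; have := E' 1 isT; have := E' 2 isT; have := E' 3 isT.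
have := E' 4 isT; rewrite !mxE /= => *; split; lra.
Qed.

Lemma wvD a b c d e a' b' c' d' e' : wv a b c d e + wv a' b' c' d' e' =
  wv (a + a') (b + b') (c + c') (d + d') (e + e').
Proof. by cV5_cases; rewrite !mxE /=; ring. Qed.

Lemma wvZ t a b c d e : t *: wv a b c d e =
  wv (t * a) (t * b) (t * c) (t * d) (t * e).
Proof. by cV5_cases; rewrite !mxE /=; ring. Qed.

Lemma wv0 : wv 0 0 0 0 0 = 0.
Proof. by cV5_cases; rewrite !mxE /=; ring. Qed.

Lemma u_e1 : u K *m e1 K = - 2^-1 *: wv 1 0 0 0 1.
Proof. by rewrite /e1; cV5_cases; rewrite mxE sum5 !mxE /=; field. Qed.

Definition eta_form (x y : 'cV[K]_5) : K := (x^T *m Defs.eta K *m y) 0 0.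

Lemma eta_form_wv a b c d e a' b' c' d' e' :
  eta_form (wv a b c d e) (wv a' b' c' d' e') =
  c * c' - 2 * (b * d' + d * b') - 2 * (a * e' + e * a').
Proof. by rewrite /eta_form -mulmxA mul_diag_mx mxE sum5 !mxE /=; ring. Qed.

Lemma eta_form_orth g x y : eta_orth g -> eta_form (g *m x) (g *m y) = eta_form x y.
Proof.
rewrite /eta_form => go; rewrite trmx_mul.
have -> : x^T *m g^T *m Defs.eta K *m (g *m y) = x^T *m (g^T *m Defs.eta K *m g) *m y.
  by rewrite !mulmxA.
by rewrite go.
Qed.

Definition lie (j1 j2 w v m l : K) : mx :=
  j1 *: J1 K + j2 *: J2 K + w *: W K + v *: V K + m *: M K + l *: L K.

Lemma E_matrix i j : (0 < i <= 5)%N -> (0 < j <= 5)%N ->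
  E K i j = \matrix_(a, b) ((a == i.-1 :> nat) && (b == j.-1 :> nat))%:R.
Proof.
case: i j => [//|i] [//|j] /= i5 j5; apply/matrixP => a b.
by rewrite !mxE -!val_eqE /= !inordK.
Qed.

Lemma lie_rows j1 j2 w v m l : lie j1 j2 w v m l = of_rows
  [:: [:: 0; m + l; j2; - (m + l); v];
      [:: - (m + l); 0; m - l; j1; w];
      [:: j2; m - l; 0; l - m; v];
      [:: - (m + l); j1; m - l; 0; w];
      [:: v; w; - v; - w; 0]].
Proof.
rewrite /lie /J1 /J2 /W /V !E_matrix //.
by mx5_cases; rewrite !mxE /=; ring.
Qed.

(** In the weight basis the element is upper triangular with diagonal
    [j1, j2, 0, - j2, - j1]. *)
Lemma lie_wv j1 j2 w v m l a b c d e :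
  lie j1 j2 w v m l *m wv a b c d e =
  wv (j1 * a - 2 * l * b + w * c - 2 * m * d) (j2 * b + v * c + 2 * m * e)
     (2 * v * d + 2 * w * e) (- j2 * d + 2 * l * e) (- j1 * e).
Proof.
rewrite lie_rows.
by cV5_cases; rewrite mxE sum5 !mxE /=; ring.
Qed.

Lemma lie_so23 j1 j2 w v m l : so23 (lie j1 j2 w v m l).
Proof.
have E : Defs.eta K = diag_mx (\row_(j < 5) nth 0 [:: -1; -1; 1; 1; 1] j).
  congr diag_mx; apply/matrixP => -[[|//] ?] -[[|[|[|[|[|//]]]]] ?]; by rewrite !mxE.
rewrite /so23 /= E mul_mx_diag mul_diag_mx.
rewrite lie_rows.
by mx5_cases; rewrite !mxE /=; ring.
Qed.

Lemma expmx_eigenvector (X : mx) (v : 'cV[K]_5) a :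
  X *m v = a *: v -> expmx X *m v = expR a *: v.
Proof.
move=> Xv; have Xn n : X ^+ n *m v = a ^+ n *: v.
  elim: n => [|n IH]; first by rewrite !expr0 mul1mx scale1r.
  by rewrite exprS -mulmxE -mulmxA IH -scalemxAr Xv scalerA -exprSr.
apply/matrixP => i j; rewrite -[_ *m v]mul1mx mulmxA.
rewrite [RHS]mxE mulrC; apply: expmx_matrix_coef => n.
by rewrite mul1mx Xn mxE mulrC.
Qed.

Lemma expmx_kernel (X : mx) (v : 'cV[K]_5) : X *m v = 0 -> expmx X *m v = v.
Proof.
by move=> Xv; rewrite (expmx_eigenvector X v 0) ?expR0 ?scale1r // scale0r.
Qed.

(** The image of the remaining basis vector is determined by its products with the
    four fixed ones and by its own norm. *)
Lemma eta_orth_eq1 g : eta_orth g ->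
  (forall a b c e, g *m wv a b c 0 e = wv a b c 0 e) -> g = 1.
Proof.
move=> go gfix.
have [a [b [c [d [e gE]]]]] := wv_surj (g *m wv 0 0 0 1 0).
have gform a' b' c' e' := eta_form_orth g (wv 0 0 0 1 0) (wv a' b' c' 0 e') go.
have := eta_form_orth g (wv 0 0 0 1 0) (wv 0 0 0 1 0) go.
have := gform 1 0 0 0; have := gform 0 1 0 0; have := gform 0 0 1 0.
have := gform 0 0 0 1; rewrite !gfix gE !eta_form_wv => E1 E2 E3 E4 E5.
have d1 : d = 1 by lra.
have c0 : c = 0 by lra.
have e0 : e = 0 by lra.
have a0 : a = 0 by lra.
have b0 : b = 0 by rewrite d1 c0 e0 a0 in E5; lra.
have gf2' : g *m wv 0 0 0 1 0 = wv 0 0 0 1 0 by rewrite gE a0 b0 c0 d1 e0.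
rewrite -[g]mulmx1; apply/matrixP => i j.
have [a' [b' [c' [d' [e' jE]]]]] := wv_surj (col j 1%:M).
have : g *m col j 1%:M = col j 1%:M.
  have -> : col j 1%:M = wv a' b' c' 0 e' + d' *: wv 0 0 0 1 0.
    by rewrite jE wvZ wvD; congr wv; ring.
  by rewrite mulmxDr -scalemxAr gfix gf2'.
by rewrite colE mul1mx -colE => /matrixP/(_ i 0); rewrite mulmx1 !mxE eqxx andbT.
Qed.

(** * Triangular isometries *)

(** The action on the span of the first three weight vectors is enough, because the
    last two steps of the weight flag are the orthogonals of the first two, and
    hence are preserved by an eta-isometry preserving those.  The entry [1] in
    position [(e5, e5)] is forced up to sign. *)
Definition borel (g : mx) (lam mu kap nu om : K) : Prop :=
  eta_orth g /\ forall a b c,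
    g *m wv a b c 0 0 = wv (lam * a + kap * b + om * c) (mu * b + nu * c) c 0 0.

Lemma borel1 : borel 1 1 1 0 0 0.
Proof.
split=> [|a b c]; first exact: eta_orth1.
by rewrite mul1mx; congr wv; ring.
Qed.

Lemma borelM g g' lam mu kap nu om lam' mu' kap' nu' om' :
  borel g lam mu kap nu om -> borel g' lam' mu' kap' nu' om' ->
  borel (g *m g') (lam * lam') (mu * mu') (lam * kap' + kap * mu') (mu * nu' + nu)
    (lam * om' + kap * nu' + om).
Proof.
move=> [go gE] [ho hE]; split=> [|a b c]; first exact: eta_orthM.
by rewrite -mulmxA hE gE; congr wv; ring.
Qed.

Lemma borelV g lam mu kap nu om : lam != 0 -> mu != 0 ->
  borel g lam mu kap nu om ->
  borel (invmx g) lam^-1 mu^-1 (- (kap / (lam * mu))) (- (nu / mu))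
    ((kap * nu / mu - om) / lam).
Proof.
move=> lam0 mu0 [go gE]; split=> [|a b c]; first exact: eta_orthV.
set v := (X in _ = X).
suff <- : g *m v = wv a b c 0 0 by rewrite mulKmx // eta_orth_unit.
by rewrite gE; congr wv; field; rewrite ?lam0 ?mu0.
Qed.

(** The inverse of the change of basis [wv]. *)
Definition weight_coord : mx := of_rows
  [:: [:: 0; 2^-1; 0; 2^-1; 0];
      [:: 2^-1; 0; 2^-1; 0; 0];
      [:: 0; 0; 0; 0; 1];
      [:: 2^-1; 0; - 2^-1; 0; 0];
      [:: 0; 2^-1; 0; - 2^-1; 0]].

Lemma weight_coordE a b c d e (i : 'I_5) :
  (weight_coord *m wv a b c d e) i 0 = nth 0 [:: a; b; c; d; e] i.
Proof.
by case: i => -[|[|[|[|[|//]]]]] ?; rewrite mxE sum5 !mxE /=; field.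
Qed.

Lemma expmx_coord X (v : 'cV[K]_5) a b c d e (i : 'I_5) x y :
  expmx X *m v = wv a b c d e ->
  (forall n, (weight_coord *m (X ^+ n *m v)) i 0 = y * x ^+ n) ->
  nth 0 [:: a; b; c; d; e] i = y * expR x.
Proof.
move=> vE Xn; rewrite -weight_coordE -vE mulmxA; apply: expmx_matrix_coef => n.
by rewrite -mulmxA Xn.
Qed.

(** Along the powers of a triangular matrix the diagonal entries are geometric and
    the entries below the diagonal vanish; [0 ^+ n] is the diagonal entry of
    [X ^+ n] for the weight [0], with value [1] at [n = 0]. *)
Lemma expmx_borel j1 j2 w v m l : exists kap nu om,
  borel (expmx (lie j1 j2 w v m l)) (expR j1) (expR j2) kap nu om.
Proof.
set X := lie _ _ _ _ _ _.
pose o k (k5 : (k < 5)%N) := Ordinal k5.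
have f1E : expmx X *m wv 1 0 0 0 0 = expR j1 *: wv 1 0 0 0 0.
  by apply: expmx_eigenvector; rewrite lie_wv wvZ; congr wv; ring.
have f2n n : exists a, X ^+ n *m wv 0 1 0 0 0 = wv a (j2 ^+ n) 0 0 0.
  elim: n => [|n [a IH]]; first by exists 0; rewrite mul1mx.
  exists (j1 * a - 2 * l * j2 ^+ n); rewrite exprS -mulmxE -mulmxA IH lie_wv.
  by congr wv; rewrite ?exprS; ring.
have e5n n : exists a b, X ^+ n *m wv 0 0 1 0 0 = wv a b (0 ^+ n) 0 0.
  elim: n => [|n [a [b IH]]]; first by exists 0, 0; rewrite mul1mx.
  exists (j1 * a - 2 * l * b + w * 0 ^+ n), (j2 * b + v * 0 ^+ n).
  by rewrite exprS -mulmxE -mulmxA IH lie_wv; congr wv; rewrite ?exprS; ring.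
have [kap [b2 [c2 [d2 [e2 f2E]]]]] := wv_surj (expmx X *m wv 0 1 0 0 0).
have [om [nu [c3 [d3 [e3 e5E]]]]] := wv_surj (expmx X *m wv 0 0 1 0 0).
have f2C k (k5 : (k < 5)%N) x y := expmx_coord X _ _ _ _ _ _ (o k k5) x y f2E.
have e5C k (k5 : (k < 5)%N) x y := expmx_coord X _ _ _ _ _ _ (o k k5) x y e5E.
have b2E : b2 = expR j2.
  rewrite -[RHS]mul1r; apply: (f2C 1 isT) => n; have [a ->] := f2n n.
  by rewrite weight_coordE mul1r.
have c2E : c2 = 0.
  rewrite -(mul0r (expR 0)); apply: (f2C 2 isT) => n; have [a ->] := f2n n.
  by rewrite weight_coordE mul0r.
have d2E : d2 = 0.
  rewrite -(mul0r (expR 0)); apply: (f2C 3 isT) => n; have [a ->] := f2n n.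
  by rewrite weight_coordE mul0r.
have e2E : e2 = 0.
  rewrite -(mul0r (expR 0)); apply: (f2C 4 isT) => n; have [a ->] := f2n n.
  by rewrite weight_coordE mul0r.
have c3E : c3 = 1.
  transitivity (1 * expR (0 : K)); last by rewrite expR0 mulr1.
  apply: (e5C 2 isT) => n; have [a [b ->]] := e5n n.
  by rewrite weight_coordE mul1r.
have d3E : d3 = 0.
  rewrite -(mul0r (expR 0)); apply: (e5C 3 isT) => n; have [a [b ->]] := e5n n.
  by rewrite weight_coordE mul0r.
have e3E : e3 = 0.
  rewrite -(mul0r (expR 0)); apply: (e5C 4 isT) => n; have [a [b ->]] := e5n n.
  by rewrite weight_coordE mul0r.
exists kap, nu, om; split.
  by apply: expmx_orth; exact: lie_so23.
move=> a b c; have -> : wv a b c 0 0 =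
    a *: wv 1 0 0 0 0 + b *: wv 0 1 0 0 0 + c *: wv 0 0 1 0 0.
  by rewrite !wvZ !wvD; congr wv; ring.
rewrite !mulmxDr -!scalemxAr f1E f2E e5E b2E c2E d2E e2E c3E d3E e3E.
by rewrite !wvZ !wvD; congr wv; ring.
Qed.

(** The relations satisfied by [R1].  With [lam = mu^2] the functions [nu],
    [kap / mu] and [mu - 1] satisfy the same rule [f (g g') = mu(g) f(g') + f(g)],
    so that any linear relation between them defines a group; the relation here
    is [nu = 2 s (mu - 1) - (r / 2) (kap / mu)] with denominators cleared. *)
Definition borel_cocycle (r s : K) : set mx := [set g | exists mu kap nu om,
  [/\ 0 < mu, borel g (mu ^+ 2) mu kap nu om &
      2 * mu * nu = 4 * s * mu * (mu - 1) - r * kap]].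

(** For [a != 0] the values of [kap] and [nu] are read off from the fact that
    [exp X] commutes with [X]; for [a = 0] the matrix [X] is nilpotent on the
    vectors concerned and the series is finite. *)
Lemma expmx_R1_cocycle r s a w m l :
  borel_cocycle r s (expmx (lie (2 * a) a w (2 * a * s + l * r) m l)).
Proof.
set X := lie _ _ _ _ _ _.
have [kap [nu [om gB]]] : exists kap nu om,
    borel (expmx X) (expR (2 * a)) (expR a) kap nu om.
  exact: expmx_borel.
have E2 : expR (2 * a) = expR a ^+ 2 by rewrite expRM_natl.
rewrite E2 in gB.
exists (expR a), kap, nu, om; split=> //; first exact: expR_gt0.
case: gB => _ gE.
have f2E := gE 0 1 0; have e5E := gE 0 0 1.
have [a0|a0] := eqVneq a 0.
  have X0 : X = lie 0 0 w (l * r) m l by rewrite /X a0 !mulr0 mul0r add0r.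
  have mu1 : expR a = 1 by rewrite a0 expR0.
  have : expmx X *m wv 0 1 0 0 0 = wv (- 2 * l) 1 0 0 0.
    rewrite (expmx_nilpotent X _ 2).
      rewrite !big_nat_recl // big_geq // expr0 expr1 mul1mx X0 lie_wv.
      by rewrite /= !fact0 !invr1 !wvZ addr0 wvD; congr wv; ring.
    rewrite expr2 -mulmxE -mulmxA X0 lie_wv lie_wv -wv0; congr wv; ring.
  have : expmx X *m wv 0 0 1 0 0 = wv (w - l * (l * r)) (l * r) 1 0 0.
    rewrite (expmx_nilpotent X _ 3).
      rewrite !big_nat_recl // big_geq // expr0 expr1 expr2 mul1mx.
      rewrite -mulmxE -mulmxA X0 !lie_wv.
      by rewrite !factS fact0 !muln1 !wvZ addr0 !wvD; congr wv; field.
    by rewrite !exprS expr0 mulr1 -!mulmxE -!mulmxA X0 !lie_wv -wv0; congr wv; ring.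
  rewrite e5E f2E => /wv_inj[_ nuE _ _ _] /wv_inj[kapE _ _ _ _].
  have -> : nu = l * r by lra.
  have -> : kap = - 2 * l by lra.
  by rewrite mu1; ring.
have comm (v : 'cV[K]_5) : expmx X *m (X *m v) = X *m (expmx X *m v).
  by rewrite !mulmxA; congr (_ *m _); exact: (expmx_intertwine X X X).
have Xf2 : X *m wv 0 1 0 0 0 = wv (- 2 * l) a 0 0 0.
  by rewrite lie_wv; congr wv; ring.
have Xe5 : X *m wv 0 0 1 0 0 = wv w (2 * a * s + l * r) 0 0 0.
  by rewrite lie_wv; congr wv; ring.
have := comm (wv 0 1 0 0 0); have := comm (wv 0 0 1 0 0).
rewrite Xf2 Xe5 f2E e5E !gE !lie_wv => /wv_inj[_ nuE _ _ _] /wv_inj[kapE _ _ _ _].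
apply: (mulfI a0).
have nuE' : a * nu = (2 * a * s + l * r) * (expR a - 1) by lra.
have kapE' : a * kap = - 2 * l * (expR a ^+ 2 - expR a) by lra.
transitivity (2 * expR a * (a * nu)); first by ring.
rewrite nuE'; transitivity (4 * s * a * expR a * (expR a - 1) - r * (a * kap)).
  by rewrite kapE'; ring.
by ring.
Qed.

Lemma borel_cocycle_subgroup r s : subgroupGL (borel_cocycle r s).
Proof.
split.
- by move=> g [mu [kap [nu [om [_ [go _] _]]]]]; exact: eta_orth_unit.
- exists 1, 0, 0, 0; split; [exact: ltr01 | rewrite expr1n; exact: borel1 | ring].
- move=> g h [mu [kap [nu [om [mu0 gB gE]]]]] [mu' [kap' [nu' [om' [mu'0 hB hE]]]]].
  exists (mu * mu'), (mu ^+ 2 * kap' + kap * mu'), (mu * nu' + nu),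
    (mu ^+ 2 * om' + kap * nu' + om); split; first exact: mulr_gt0.
    by rewrite exprMn; exact: borelM.
  transitivity (mu ^+ 2 * (2 * mu' * nu') + mu' * (2 * mu * nu)); first by ring.
  by rewrite gE hE; ring.
- move=> g [mu [kap [nu [om [mu0 gB gE]]]]].
  have mu_neq0 : mu != 0 by rewrite gt_eqF.
  exists mu^-1, (- (kap / (mu ^+ 2 * mu))), (- (nu / mu)),
    ((kap * nu / mu - om) / mu ^+ 2); split; first by rewrite invr_gt0.
    by rewrite exprVn; apply: borelV => //; rewrite expf_neq0.
  have -> : nu = (4 * s * mu * (mu - 1) - r * kap) / (2 * mu).
    by rewrite -gE; field.
  by field.
Qed.

(** * The analytic subgroups R and R1 *)

Lemma subgroupGL_sub_unit (S : set mx) g : subgroupGL S -> S g -> g \in unitmx.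
Proof. by case=> SU _ _ _; exact: SU. Qed.

Lemma subgroupGLM (S : set mx) g h : subgroupGL S -> S g -> S h -> S (g *m h).
Proof. by case=> _ _ SM _; exact: SM. Qed.

Lemma subgroupGLV (S : set mx) g : subgroupGL S -> S g -> S (invmx g).
Proof. by case=> _ _ _ SV; exact: SV. Qed.

Lemma subgroupGL_unit : subgroupGL [set g : mx | g \in unitmx].
Proof.
split=> //=; first exact: unitmx1.
- by move=> g h gu hu; rewrite unitmx_mul gu hu.
- by move=> g; rewrite unitmx_inv.
Qed.

Lemma expmx_unit (X : mx) : expmx X \in unitmx.
Proof. by case: (mulmx1_unit (expmxN X)). Qed.

Lemma analytic_subgroup_subgroupGL (h : {vspace mx}) :
  subgroupGL (analytic_subgroup h).
Proof.
split.
- apply: smallest_sub; first exact: subgroupGL_unit.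
  by move=> _ [X _ <-]; exact: expmx_unit.
- by move=> S [[_ S1 _ _] _].
- move=> g k gS kS S SP; have [[_ _ SM _] _] := SP.
  by apply: SM; [exact: gS | exact: kS].
- move=> g gS S SP; have [[_ _ _ SV] _] := SP.
  by apply: SV; exact: gS.
Qed.

Lemma expmx_analytic_subgroup (h : {vspace mx}) X :
  X \in h -> analytic_subgroup h (expmx X).
Proof. by move=> Xh; apply: sub_gen_smallest; exists X. Qed.

Lemma R_expmx j1 j2 w v m l : R K (expmx (lie j1 j2 w v m l)).
Proof.
apply: expmx_analytic_subgroup; rewrite /lie.
by rewrite !memvD ?memvZ // memv_span // !inE eqxx ?orbT.
Qed.

Lemma lie_R1 r s a w m l : lie (2 * a) a w (2 * a * s + l * r) m l =
  (2 * a) *: (J1 K + 2^-1 *: J2 K + s *: V K) + w *: W K + m *: M K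
  + l *: (L K + r *: V K).
Proof.
rewrite /lie; move: (J1 K) (J2 K) (W K) (V K) (M K) (L K) => A1 A2 A3 A4 A5 A6.
by apply/matrixP => i j; rewrite !mxE; field.
Qed.

Lemma R1_expmx r s a w m l :
  R1 r s (expmx (lie (2 * a) a w (2 * a * s + l * r) m l)).
Proof.
apply: expmx_analytic_subgroup; rewrite lie_R1.
by rewrite !memvD ?memvZ // memv_span // !inE eqxx ?orbT.
Qed.

Lemma mem_span_R X : X \in <<[:: J1 K; J2 K; W K; V K; M K; L K]>>%VS ->
  exists j1 j2 w v m l, X = lie j1 j2 w v m l.
Proof.
rewrite !span_cons span_nil addv0.
move=> /memv_addP[_ /vlineP[j1 ->]
  [_ /memv_addP[_ /vlineP[j2 ->]
  [_ /memv_addP[_ /vlineP[w ->]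
  [_ /memv_addP[_ /vlineP[v ->]
  [_ /memv_addP[_ /vlineP[m ->] [_ /vlineP[l ->] ->]] ->]] ->]] ->]] ->]].
by exists j1, j2, w, v, m, l; rewrite /lie !addrA.
Qed.

Lemma mem_span_R1 r s X :
  X \in <<[:: J1 K + 2^-1 *: J2 K + s *: V K; W K; M K; L K + r *: V K]%R>>%VS ->
  exists a w m l, X = lie (2 * a) a w (2 * a * s + l * r) m l.
Proof.
rewrite !span_cons span_nil addv0.
move=> /memv_addP[_ /vlineP[j ->]
  [_ /memv_addP[_ /vlineP[w ->]
  [_ /memv_addP[_ /vlineP[m ->] [_ /vlineP[l ->] ->]] ->]] ->]].
exists (j / 2), w, m, l; rewrite lie_R1 mulrC divfK ?pnatr_eq0 //.
by rewrite !addrA.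
Qed.

Definition borel_pos : set mx := [set g | exists lam mu kap nu om,
  [/\ 0 < lam, 0 < mu & borel g lam mu kap nu om]].

Lemma borel_pos_subgroup : subgroupGL borel_pos.
Proof.
split.
- by move=> g [? [? [? [? [? [_ _ [go _]]]]]]]; exact: eta_orth_unit.
- by exists 1, 1, 0, 0, 0; split; [exact: ltr01 | exact: ltr01 | exact: borel1].
- move=> g h [? [? [? [? [? [l0 m0 gB]]]]]] [? [? [? [? [? [l0' m0' hB]]]]]].
  do 5 eexists; split; last exact: borelM gB hB.
  + exact: mulr_gt0.
  + exact: mulr_gt0.
- move=> g [lam [mu [? [? [? [l0 m0 gB]]]]]].
  do 5 eexists; split; last first.
  + by apply: borelV gB; rewrite gt_eqF.
  + by rewrite invr_gt0.
  + by rewrite invr_gt0.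
Qed.

Lemma R_borel : R K `<=` borel_pos.
Proof.
apply: smallest_sub; first exact: borel_pos_subgroup.
move=> _ [_ /mem_span_R[j1 [j2 [w [v [m [l ->]]]]]] <-].
have [kap [nu [om gB]]] := expmx_borel j1 j2 w v m l.
by exists (expR j1), (expR j2), kap, nu, om; rewrite !expR_gt0.
Qed.

Lemma R1_borel_cocycle r s : R1 r s `<=` borel_cocycle r s.
Proof.
apply: smallest_sub; first exact: borel_cocycle_subgroup.
move=> _ [_ /mem_span_R1[a [w [m [l ->]]]] <-]; exact: expmx_R1_cocycle.
Qed.

Lemma R1_sub_R r s : R1 r s `<=` R K.
Proof.
apply: smallest_sub; first exact: analytic_subgroup_subgroupGL.
by move=> _ [_ /mem_span_R1[a [w [m [l ->]]]] <-]; exact: R_expmx.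
Qed.

(** The elements of [G] with inverse in [G] form a group, and it contains [exp X]
    together with its inverse [exp (- X)]. *)
Lemma R_sub_G : R K `<=` G K.
Proof.
pose T := [set g : mx | G K g /\ G K (invmx g)].
suff : R K `<=` T by move=> RT g /RT[].
apply: smallest_sub.
  split.
  - by move=> g [/connected_component_sub[go _] _]; exact: eta_orth_unit.
  - by split; rewrite ?invmx1; exact: G1.
  - move=> g h [Gg Gg'] [Gh Gh']; split; first exact: GM.
    have gu : g \in unitmx.
      by case: (connected_component_sub Gg) => go _; exact: eta_orth_unit.
    have hu : h \in unitmx.
      by case: (connected_component_sub Gh) => ho _; exact: eta_orth_unit.
    suff -> : invmx (g *m h) = invmx h *m invmx g by exact: GM.
    exact: (@invrM mx).
  - by move=> g [Gg Gg']; split; rewrite ?invmxK.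
move=> _ [_ /mem_span_R[j1 [j2 [w [v [m [l ->]]]]]] <-].
have Xo := lie_so23 j1 j2 w v m l.
split; first exact: expmx_G.
suff -> : invmx (expmx (lie j1 j2 w v m l)) = expmx (- lie j1 j2 w v m l).
  by apply: expmx_G; rewrite -scaleN1r; exact: so23Z.
by rewrite -[LHS]mul1mx -[1%:M](expmxN (lie j1 j2 w v m l)) mulmxK ?expmx_unit.
Qed.

(** * Transitivity of R1 on the orbit of e2 *)

(** Although [J1 + J2/2 + s V] is not diagonal in the weight basis, the extreme
    vectors [f1] and [f1'] are eigenvectors, and [2 e2 = f1 + f1']. *)
Lemma R1_expmx_J r s t : exists2 A, R1 r s A &
  A *m wv 1 0 0 0 1 = wv (expR t) 0 0 0 (expR (- t)).
Proof.
exists (expmx (lie (2 * (t / 2)) (t / 2) 0 (2 * (t / 2) * s + 0 * r) 0 0)).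
  exact: R1_expmx.
have t2 : 2 * (t / 2) = t by rewrite mulrC divfK ?pnatr_eq0.
have -> : wv 1 0 0 0 1 = wv 1 0 0 0 0 + wv 0 0 0 0 1 by rewrite wvD; congr wv; ring.
rewrite mulmxDr (expmx_eigenvector _ (wv 1 0 0 0 0) t); last first.
  by rewrite lie_wv wvZ t2; congr wv; ring.
rewrite (expmx_eigenvector _ (wv 0 0 0 0 1) (- t)); last first.
  by rewrite lie_wv wvZ t2; congr wv; ring.
by rewrite !wvZ wvD; congr wv; ring.
Qed.

(** [L + r V] runs through the whole chain [f1' -> f2' -> e5 -> f2 -> f1], so
    its fifth power vanishes. *)
Lemma R1_expmx_L r s x : exists2 A, R1 r s A & forall a e,
  A *m wv a 0 0 0 e =
  wv (a - r ^+ 2 * x ^+ 4 / 3 * e) (2 * r ^+ 2 * x ^+ 3 / 3 * e)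
     (2 * r * x ^+ 2 * e) (2 * x * e) e.
Proof.
exists (expmx (lie (2 * 0) 0 0 (2 * 0 * s + x * r) 0 x)); first exact: R1_expmx.
move=> a e; rewrite !mulr0 mul0r add0r (expmx_nilpotent _ _ 5).
  rewrite !big_nat_recl // big_geq // !exprS expr0 !mulr1 -!mulmxE -!mulmxA.
  rewrite mul1mx !lie_wv.
  by rewrite !factS fact0 !muln1 !wvZ addr0 !wvD; congr wv; field.
by rewrite !exprS expr0 mulr1 -!mulmxE -!mulmxA !lie_wv -wv0; congr wv; ring.
Qed.

Lemma R1_expmx_W r s x : exists2 A, R1 r s A & forall a b c d e,
  A *m wv a b c d e = wv (a + x * c + x ^+ 2 * e) b (c + 2 * x * e) d e.
Proof.
exists (expmx (lie (2 * 0) 0 x (2 * 0 * s + 0 * r) 0 0)); first exact: R1_expmx.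
move=> a b c d e; rewrite !mulr0 !mul0r add0r (expmx_nilpotent _ _ 3).
  rewrite !big_nat_recl // big_geq // !exprS expr0 !mulr1 -!mulmxE -!mulmxA.
  rewrite mul1mx !lie_wv.
  by rewrite !factS fact0 !muln1 !wvZ addr0 !wvD; congr wv; field.
by rewrite !exprS expr0 mulr1 -!mulmxE -!mulmxA !lie_wv -wv0; congr wv; ring.
Qed.

Lemma R1_expmx_M r s x : exists2 A, R1 r s A & forall a b c d e,
  A *m wv a b c d e = wv (a - 2 * x * d) (b + 2 * x * e) c d e.
Proof.
exists (expmx (lie (2 * 0) 0 0 (2 * 0 * s + 0 * r) x 0)); first exact: R1_expmx.
move=> a b c d e; rewrite !mulr0 !mul0r add0r (expmx_nilpotent _ _ 2).
  rewrite !big_nat_recl // big_geq // !exprS expr0 !mulr1 mul1mx !lie_wv.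
  by rewrite !factS fact0 !muln1 !wvZ addr0 !wvD; congr wv; field.
by rewrite !exprS expr0 mulr1 -!mulmxE -!mulmxA !lie_wv -wv0; congr wv; ring.
Qed.

(** Let [p] be the image of [2 e2 = f1 + f1'].  Its [f1'] coordinate [e] is positive,
    being the inverse of [lam]; [- ln e] is the parameter of the first factor.  The
    coordinates along [f2'], [e5] and [f2] are then matched one after the other,
    and the [f1] coordinate is determined by the norm since [e != 0]. *)
Lemma R1_transitive_points r s g : borel_pos g ->
  exists2 h, R1 r s h & h *m wv 1 0 0 0 1 = g *m wv 1 0 0 0 1.
Proof.
move=> [lam [mu [kap [nu [om [lam0 mu0 [go gE]]]]]]].
have [a [b [c [d [e pE]]]]] := wv_surj (g *m wv 1 0 0 0 1).
have pp : eta_form (wv a b c d e) (wv a b c d e) = -4.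
  by rewrite -pE eta_form_orth // eta_form_wv; ring.
have : eta_form (wv a b c d e) (g *m wv 1 0 0 0 0) = - 2.
  by rewrite -pE eta_form_orth // eta_form_wv; ring.
rewrite gE eta_form_wv => pf1.
have lame : lam * e = 1 by lra.
have e0 : 0 < e by rewrite -(pmulr_rgt0 _ lam0) lame.
have e_neq0 : e != 0 by rewrite gt_eqF.
have [At Rt Et] := R1_expmx_J r s (- ln e).
rewrite opprK expRN lnK // in Et.
have [Al Rl El] := R1_expmx_L r s (d / (2 * e)); set xl := d / (2 * e) in El.
have [Aw Rw Ew] := R1_expmx_W r s ((c - 2 * r * xl ^+ 2 * e) / (2 * e)).
have [Am Rm Em] := R1_expmx_M r s ((b - 2 * r ^+ 2 * xl ^+ 3 / 3 * e) / (2 * e)).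
have RM a1 a2 : R1 r s a1 -> R1 r s a2 -> R1 r s (a1 *m a2).
  exact: (subgroupGLM _ _ _ (analytic_subgroup_subgroupGL _)).
pose h := Am *m (Aw *m (Al *m At)).
have Rh : R1 r s h by exact: (RM _ _ Rm (RM _ _ Rw (RM _ _ Rl Rt))).
exists h => //; rewrite pE.
have [a' hE] : exists a', h *m wv 1 0 0 0 1 = wv a' b c d e.
  rewrite /h -!mulmxA Et El Ew Em; eexists; congr wv.
  - by field.
  - by field.
  - by rewrite /xl; field.
have ho : eta_orth h by case: (R1_borel_cocycle _ _ _ Rh) => ? [? [? [? [_ []]]]].
have hh : eta_form (wv a' b c d e) (wv a' b c d e) = -4.
  by rewrite -hE eta_form_orth // eta_form_wv; ring.
rewrite hE; congr wv; apply: (mulfI e_neq0).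
by move: pp hh; rewrite !eta_form_wv; lra.
Qed.

(** * The stabilizer of e2 *)

(** The vector [wv 1 0 0 0 1] is [2 e2], a multiple of [u e1]. *)
Definition e2_stab : set mx := [set g | g *m wv 1 0 0 0 1 = wv 1 0 0 0 1].

Lemma expmx_J2 j a b c e :
  expmx (lie 0 j 0 0 0 0) *m wv a b c 0 e = wv a (expR j * b) c 0 e.
Proof.
have -> : wv a b c 0 e = wv 0 b 0 0 0 + wv a 0 c 0 e by rewrite wvD; congr wv; ring.
rewrite mulmxDr (expmx_eigenvector _ (wv 0 b 0 0 0) j); last first.
  by rewrite lie_wv wvZ; congr wv; ring.
rewrite (expmx_kernel _ (wv a 0 c 0 e)); last first.
  by rewrite lie_wv -wv0; congr wv; ring.
by rewrite wvZ wvD; congr wv; ring.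
Qed.

Lemma expmx_V v a b c e :
  expmx (lie 0 0 0 v 0 0) *m wv a b c 0 e = wv a (b + v * c) c 0 e.
Proof.
rewrite (expmx_nilpotent _ _ 2).
  rewrite !big_nat_recl // big_geq // expr0 expr1 mul1mx lie_wv.
  by rewrite !factS fact0 !muln1 !wvZ addr0 !wvD; congr wv; field.
by rewrite expr2 -mulmxE -mulmxA !lie_wv -wv0; congr wv; ring.
Qed.

(** Comparing products with [e2] gives [lam = 1], so [f1] is fixed, hence so is
    [f1'], and products with [f1'] then kill [kap] and [om].  The element agrees
    with [exp (nu V) exp (ln mu J2)] on all the weight vectors but [f2'], hence
    everywhere by [eta_orth_eq1]. *)
Lemma borel_pos_e2_stab g lam mu kap nu om : 0 < lam -> 0 < mu ->
  borel g lam mu kap nu om -> e2_stab g ->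
  [/\ lam = 1, kap = 0, om = 0 &
      g = expmx (lie 0 0 0 nu 0 0) *m expmx (lie 0 (ln mu) 0 0 0 0)].
Proof.
move=> lam0 mu0 [go gE] gfix.
have := eta_form_orth g (wv 1 0 0 0 1) (wv 1 0 0 0 0) go.
rewrite gfix gE !eta_form_wv => lamE.
have lam1 : lam = 1 by lra.
have gf1 : g *m wv 1 0 0 0 0 = wv 1 0 0 0 0 by rewrite gE lam1; congr wv; ring.
have gf5 : g *m wv 0 0 0 0 1 = wv 0 0 0 0 1.
  have -> : wv 0 0 0 0 1 = wv 1 0 0 0 1 - wv 1 0 0 0 0.
    by rewrite -scaleN1r wvZ wvD; congr wv; ring.
  by rewrite mulmxBr gfix gf1.
have := eta_form_orth g (wv 0 1 0 0 0) (wv 0 0 0 0 1) go.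
rewrite gf5 gE !eta_form_wv => kapE.
have kap0 : kap = 0 by lra.
have := eta_form_orth g (wv 0 0 1 0 0) (wv 0 0 0 0 1) go.
rewrite gf5 gE !eta_form_wv => omE.
have om0 : om = 0 by lra.
split=> //; set h := _ *m _.
have ho : eta_orth h.
  by apply: eta_orthM; apply: expmx_orth; exact: lie_so23.
have hE a b c e : h *m wv a b c 0 e = wv a (mu * b + nu * c) c 0 e.
  by rewrite /h -mulmxA expmx_J2 expmx_V lnK.
have hu := eta_orth_unit h ho.
suff : invmx h *m g = 1 by move=> /(congr1 (mulmx h)); rewrite mulKVmx // mulmx1.
apply: eta_orth_eq1; first by apply: eta_orthM => //; exact: eta_orthV.
move=> a b c e; rewrite -mulmxA.
suff -> : g *m wv a b c 0 e = h *m wv a b c 0 e by rewrite mulKmx.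
rewrite hE; have -> : wv a b c 0 e = wv a b c 0 0 + e *: wv 0 0 0 0 1.
  by rewrite wvZ wvD; congr wv; ring.
by rewrite mulmxDr gE -scalemxAr gf5 wvZ wvD lam1 kap0 om0; congr wv; ring.
Qed.

Lemma R1_e2_stab r s g : R1 r s g -> e2_stab g -> g = 1.
Proof.
move=> /R1_borel_cocycle[mu [kap [nu [om [mu0 gB gE]]]]] gfix.
have [mu2 kap0 _ ->] := borel_pos_e2_stab _ _ _ _ _ _ (exprn_gt0 2 mu0) mu0 gB gfix.
have mu1 : mu = 1.
  by apply/eqP; rewrite -(@eqrXn2 _ 2) ?ler01 ?expr1n ?mu2 // ltW.
have nu0 : nu = 0 by move: gE; rewrite mu1 kap0; lra.
rewrite mu1 nu0 ln1.
have -> : lie 0 0 0 0 0 0 = 0 by rewrite /lie !scale0r !addr0.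
by rewrite expmx0 mulmx1.
Qed.

(** The conjugate [Y] of [X] by [u] is in so(2,3) and kills [e1], so [exp (t Y)] is
    a path in the stabilizer of [e1] in [G]. *)
Lemma expmx_conj_u_H X : so23 X -> X *m (u K *m e1 K) = 0 ->
  H K (invmx (u K) *m expmx X *m u K).
Proof.
move=> Xo Xe2.
have uo : eta_orth (u K) by case: (connected_component_sub u_G).
have uu := eta_orth_unit _ uo.
pose Y := invmx (u K) *m X *m u K.
have -> : invmx (u K) *m expmx X *m u K = expmx Y.
  suff E : expmx X *m u K = u K *m expmx Y by rewrite -mulmxA E mulKmx.
  by apply: expmx_intertwine; rewrite /Y -!mulmxE !mulmxA mulmxV // mul1mx.
have Yo : so23 Y.
  have etauV : Defs.eta K *m invmx (u K) = (u K)^T *m Defs.eta K.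
    by apply: (canLR (mulmxK uu)); rewrite uo.
  have uVeta : (invmx (u K))^T *m Defs.eta K = Defs.eta K *m u K.
    have uVu : invmx (u K) \in unitmx by rewrite unitmx_inv.
    rewrite -{2}[u K]invmxK; apply: (canRL (mulmxK uVu)); exact: eta_orthV.
  rewrite /so23 /= /Y !trmx_mul !mulmxA etauV -(mulmxA _ _ (Defs.eta K)) uVeta.
  by rewrite mulmxA -[_ *m X^T *m _]mulmxA [X^T *m _]Xo mulmxN mulNmx !mulmxA.
have YZ t : H K (expmx (t *: Y)).
  apply: (path_in_component _ (fun t => expmx (t *: Y))).
  - exact: expmx_continuous.
  - by rewrite scale0r expmx0.
  move=> {}t; split; first by apply: expmx_G; exact: so23Z.
  by apply: expmx_kernel; rewrite -scalemxAl /Y -!mulmxA Xe2 mulmx0 scaler0.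
by rewrite -[Y]scale1r.
Qed.

(** * Orbits of cosets *)

Lemma ltransM (g h : mx) (X : set mx) : ltrans g (ltrans h X) = ltrans (g *m h) X.
Proof.
apply/seteqP; split=> [_ [_ [x Xx <-] <-]|_ [x Xx <-]].
  by exists x => //; rewrite mulmxA.
by exists (h *m x); [exists x | rewrite mulmxA].
Qed.

Lemma ltrans1 (X : set mx) : ltrans 1 X = X.
Proof.
apply/seteqP; split=> [_ [x Xx <-]|x Xx]; first by rewrite mul1mx.
by exists x => //; rewrite mul1mx.
Qed.

Lemma ltransK (g : mx) (X : set mx) :
  g \in unitmx -> ltrans (invmx g) (ltrans g X) = X.
Proof. by move=> gu; rewrite ltransM mulVmx ?ltrans1. Qed.

Lemma e2_stabE (g : mx) : e2_stab g <-> g *m (u K *m e1 K) = u K *m e1 K.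
Proof.
have half0 : - 2^-1 != 0 :> K by rewrite oppr_eq0 invr_eq0 pnatr_eq0.
by rewrite u_e1 -scalemxAr; split=> [-> //|]; exact: (scalerI half0).
Qed.

Lemma R_unit (g : mx) : R K g -> g \in unitmx.
Proof. exact: (subgroupGL_sub_unit _ _ (analytic_subgroup_subgroupGL _)). Qed.

Lemma e2_stab_conj_H (g : mx) : R K g -> e2_stab g -> H K (invmx (u K) *m g *m u K).
Proof.
move=> /R_borel[lam [mu [kap [nu [om [lam0 mu0 gB]]]]]] gfix.
have [_ _ _ ->] := borel_pos_e2_stab _ _ _ _ _ _ lam0 mu0 gB gfix.
have uu : u K \in unitmx.
  by apply: eta_orth_unit; case: (connected_component_sub u_G).
have conjM (A B : mx) : invmx (u K) *m (A *m B) *m u K =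
    (invmx (u K) *m A *m u K) *m (invmx (u K) *m B *m u K).
  by rewrite -!mulmxA (mulKVmx uu).
rewrite conjM.
have Xe2 X : X *m wv 1 0 0 0 1 = 0 -> X *m (u K *m e1 K) = 0.
  by move=> X0; rewrite u_e1 -scalemxAr X0 scaler0.
apply: HM; apply: expmx_conj_u_H; try exact: lie_so23; apply: Xe2.
  by rewrite lie_wv -wv0; congr wv; ring.
by rewrite lie_wv -wv0; congr wv; ring.
Qed.

Lemma ltrans_H (k : mx) : k \in unitmx -> H K k -> H K (invmx k) ->
  ltrans k (H K) = H K.
Proof.
move=> ku Hk HkV; apply/seteqP; split=> [_ [h Hh <-]|h Hh]; first exact: HM.
by exists (invmx k *m h); [exact: HM | rewrite mulKVmx].
Qed.

(** [g u H = u k H] with [k = u^-1 g u], and [k H = H] because both [k] and its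
    inverse, which comes from [g^-1], lie in [H]. *)
Lemma ltrans_cls_u (g : mx) : R K g -> e2_stab g -> ltrans g (cls (u K)) = cls (u K).
Proof.
move=> Rg gfix; have gu := R_unit g Rg.
have uu : u K \in unitmx.
  by apply: eta_orth_unit; case: (connected_component_sub u_G).
have RgV : R K (invmx g) := subgroupGLV _ _ (analytic_subgroup_subgroupGL _) Rg.
have gVfix : e2_stab (invmx g) by rewrite /e2_stab /= -{1}gfix mulKmx.
rewrite /cls ltransM -{1}(mulKVmx uu (g *m u K)) -ltransM; congr ltrans.
rewrite mulmxA; apply: ltrans_H.
- by rewrite !unitmx_mul unitmx_inv uu gu.
- exact: e2_stab_conj_H.
have -> : invmx (invmx (u K) *m g *m u K) = invmx (u K) *m invmx g *m u K.
  have E : (invmx (u K) *m invmx g *m u K) *m (invmx (u K) *m g *m u K) = 1%:M.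
    by rewrite -!mulmxA (mulKVmx uu) (mulKmx gu) mulVmx.
  have [_ ku] := mulmx1_unit E.
  by rewrite -[RHS](mulmxK ku) E mul1mx.
exact: e2_stab_conj_H.
Qed.

(** The factorization [R = R1 S]: if [h] in [R1] and [g] in [R] move [e2] to the same
    point then [h^-1 g] is in [S], so [g] and [h] move the base coset to the same
    coset. *)
Lemma U_R1_orbit r s : U K = Defs.orbit (R1 r s) (cls (u K)).
Proof.
apply/seteqP; split=> _ [g Rg <-]; last by exists g => //; exact: (R1_sub_R r s).
have [h Rh hE] := R1_transitive_points r s g (R_borel g Rg).
have RhK : R K h := R1_sub_R r s _ Rh.
have hu := R_unit h RhK.
have group : subgroupGL (R K) := analytic_subgroup_subgroupGL _.
exists h => //; rewrite -(mulKVmx hu g) -ltransM; congr ltrans; apply/esym.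
apply: ltrans_cls_u; last by rewrite /e2_stab /= -mulmxA -hE mulKmx.
exact: (subgroupGLM (R K) _ _ group (subgroupGLV (R K) _ group RhK) Rg).
Qed.

Lemma R1_cls_u_free r s (g : mx) :
  R1 r s g -> ltrans g (cls (u K)) = cls (u K) -> g = 1.
Proof.
move=> Rg gfix; apply: (R1_e2_stab r s) => //; apply/e2_stabE.
have : ltrans g (cls (u K)) (g *m u K).
  by exists (u K) => //; exists 1; [exact: H1 | rewrite mulmx1].
by rewrite gfix mulmxA => -[h Hh <-]; rewrite -mulmxA H_e1.
Qed.

End AntiDeSitter.

Theorem proposition2p7 (K : realType) (r s : K) (hr : r <> 0) :
  [/\ U K `<=` AdS4 K,
      acts_on (R1 r s) (U K),
      acts_freely (R1 r s) (U K) &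
      acts_simply_transitively (R1 r s) (U K)].
Proof.
have R1g : subgroupGL (R1 r s) := analytic_subgroup_subgroupGL K _.
have R1U g : R1 r s g -> g \in unitmx by case: R1g => R1U _ _ _; exact: R1U.
have free : acts_freely (R1 r s) (U K).
  move=> g x Rg; rewrite (U_R1_orbit K r s) => -[a Ra <-] ga.
  have au := R1U a Ra.
  suff : invmx a *m g *m a = 1.
    move=> /(congr1 (fun x => a *m x *m invmx a)).
    by rewrite !mulmxA mulmxV // mul1mx mulmxK // mulmx1 mulmxV.
  apply: (R1_cls_u_free K r s).
    apply: (subgroupGLM K (R1 r s)) => //; apply: (subgroupGLM K (R1 r s)) => //.
    exact: (subgroupGLV K (R1 r s)).
  by rewrite -!ltransM ga ltransK.
split=> //.
- move=> _ [g Rg <-]; rewrite /cls ltransM; exists (g *m u K) => //.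
  by apply: GM; [exact: R_sub_G | exact: u_G].
- move=> g _ Rg [h Rh <-]; rewrite ltransM; exists (g *m h) => //.
  apply: (subgroupGLM K (R K)) => //; first exact: analytic_subgroup_subgroupGL.
  exact: (R1_sub_R K r s).
move=> x y Ux Uy; move: (Ux) (Uy); rewrite (U_R1_orbit K r s).
move=> [a Ra ax] [b Rb bY]; have au := R1U a Ra.
exists (b *m invmx a); split.
  split.
    by apply: (subgroupGLM K (R1 r s)) => //; exact: (subgroupGLV K (R1 r s)).
  by rewrite -ax -ltransM ltransK.
move=> g [Rg gx]; have gu := R1U g Rg.
have : invmx g *m (b *m invmx a) = 1.
  apply: (free _ x) => //.
    apply: (subgroupGLM K (R1 r s)) => //; first exact: (subgroupGLV K (R1 r s)).
    by apply: (subgroupGLM K (R1 r s)) => //; exact: (subgroupGLV K (R1 r s)).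
  rewrite -!ltransM -{1}ax ltransK // bY -gx ltransK //.
by move=> /(congr1 (mulmx g)); rewrite mulKVmx // mulmx1.
Qed.
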